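(* Let $n$ be a positive integer and let $S$ be a set of cells of an $n\times n$ array having exactly $r_i$ cells in the $i$-th row and exactly $c_j$ cells in the $j$-th column ($1\le i,j\le n$). Then the number of partial Latin squares of order $n$ with shape $S$ is at most $$\left(\prod_{i=1}^{n} n!^{\frac{n-r_i}{n}}\frac{1}{(n-r_i)!}\right)\left(\prod_{i=1}^{n}\prod_{j=0}^{c_i-1}(n-j)!^{\frac{1}{n-j}}\right).$$
   Context: A partial Latin square of order $n$ is an $n\times n$ array, some cells possibly empty, with entries from $\{1,\dots,n\}$ such that each symbol occurs at most once in each row and at most once in each column. Its shape is the set of positions $(i,j)$ of its filled cells. Thus a partial Latin square of shape $S$ is a filling of exactly the cells of $S$ with symbols from $\{1,\dots,n\}$ satisfying the Latin property. *)

(* Defs.v *)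
(* MathComp / MathComp-Analysis *)
From mathcomp Require Import all_boot all_order all_algebra.
From mathcomp Require Import reals exp.
Set Implicit Arguments.
Unset Strict Implicit.
Unset Printing Implicit Defensive.
Import Order.TTheory GRing.Theory Num.Theory.

(* Rows, columns and symbols are numbered 0, ..., n-1 instead of 1, ..., n;
   [None] marks an empty cell. *)
Definition partial_array (n : nat) := {ffun 'I_n * 'I_n -> option 'I_n}.

Definition partial_latin_square (n : nat) (L : partial_array n) : bool :=
  [forall i : 'I_n, forall k : 'I_n, #|[set j : 'I_n | L (i, j) == Some k]| <= 1]
  && [forall j : 'I_n, forall k : 'I_n,
        #|[set i : 'I_n | L (i, j) == Some k]| <= 1].

Definition pls_shape (n : nat) (L : partial_array n) : {set 'I_n * 'I_n} :=
  [set x | L x != None].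

(* Main.v *)
Require Import Defs.
From mathcomp Require Import all_boot all_order all_algebra all_fingroup.
From mathcomp Require Import ring lra zify.
From mathcomp Require Import reals exp.
Set Implicit Arguments.
Unset Strict Implicit.
Unset Printing Implicit Defensive.
Import Order.TTheory GRing.Theory Num.Theory.
Local Open Scope ring_scope.

(* Fill the array row by row.  Given the rows above row [i], the cell [(i, j)]
   of the shape has [n - m] available symbols, where [m] is the number of cells
   of the shape above it.  Bregman's bound on permanents, applied after
   completing the row to a permutation, bounds the number of ways to fill row
   [i]; in the product over all rows, column [j] contributes the factors of
   index [n], [n - 1], ..., [n - c j + 1].  Bregman's bound is proved by
   Schrijver's convexity argument, in logarithmic form. *)

(** * Bregman's bound on permanents *)

(* Jensen's inequality for [x ln x], the [x] being the fiber sizes. *)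
Lemma sum_ln_fiber_le (R : realType) (X T : finType) (P : {set X}) (f : X -> T)
    (B : {set T}) :
  (forall x, x \in P -> f x \in B) ->
  \sum_(x in P) ln (#|P|%:R : R) <=
  \sum_(x in P) (ln (#|B|%:R : R) + ln #|[set y in P | f y == f x]|%:R).
Proof.
move=> fB; pose q k := #|[set y in P | f y == k]|.
have q_gt0 x : x \in P -> (0 < q (f x))%N.
  by move=> xP; apply/card_gt0P; exists x; rewrite inE xP eqxx.
(* Each nonempty fiber contributes exactly 1 to this sum, and there are at most [#|B|] of them. *)
have sum_inv : \sum_(x in P) ((q (f x))%:R : R)^-1 <= #|B|%:R.
  rewrite (partition_big f (mem B)) //= -sumr_const.
  apply: ler_sum => k _.
  rewrite (eq_bigr (fun=> (q k)%:R^-1)); last by move=> x /andP[_ /eqP->].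
  rewrite (eq_bigl [in [set y in P | f y == k]]); last by move=> x; rewrite /= inE.
  rewrite sumr_const -/(q k) -[leLHS]mulr_natl.
  by case: (q k) => [|m]; [rewrite mul0r ler01 | rewrite divff ?pnatr_eq0].
(* This is [ln y <= y - 1] at [y = #|P| / (#|B| * q (f x))]; summed over [P], the right-hand side is
   at most 0 by [sum_inv]. *)
have term x : x \in P ->
    ln (#|P|%:R : R) - (ln (#|B|%:R : R) + ln (q (f x))%:R)
    <= #|P|%:R / #|B|%:R * (q (f x))%:R^-1 - 1.
  move=> xP; have P0 : 0 < #|P|%:R :> R by rewrite ltr0n; apply/card_gt0P; exists x.
  have B0 : 0 < #|B|%:R :> R.
    by rewrite ltr0n; apply/card_gt0P; exists (f x); apply: fB.
  have q0 : 0 < (q (f x))%:R :> R by rewrite ltr0n q_gt0.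
  rewrite opprD addrA -ln_div ?posrE // -ln_div ?posrE ?divr_gt0 //.
  set y := _ / _ in P0 *; have y0 : 0 < y by rewrite !divr_gt0.
  rewrite (_ : ln y = ln (1 + (y - 1))); last by congr ln; ring.
  by apply: le_ln1Dx; lra.
rewrite -subr_le0 -sumrB; apply: le_trans (ler_sum _ term) _.
rewrite sumrB sumr_const -mulr_sumr subr_le0.
have [->|B0] := eqVneq #|B| 0%N; first by rewrite invr0 mulr0 mul0r ler0n.
rewrite mulrAC ler_pdivrMr ?ltr0n ?lt0n // ler_wpM2l //.
Qed.

(* [n`! `^ (1 / n)] in logarithmic form, with value [0] at [n = 0] *)
Definition lnfact_mean (R : realType) (n : nat) : R := ln (n`!)%:R / n%:R.

Lemma lnfact_mean_ge0 (R : realType) n : 0 <= lnfact_mean R n.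
Proof. by rewrite divr_ge0 // ln_ge0 // ler1n fact_gt0. Qed.

(** The recursion of the factorial in logarithms. It merges the choice of a value in a row of size
    [n.+1] with [n] copies of that row shortened by one. *)
Lemma lnfact_meanS (R : realType) n :
  ln (n.+1%:R : R) + n%:R * lnfact_mean R n = n.+1%:R * lnfact_mean R n.+1.
Proof.
rewrite /lnfact_mean [RHS]mulrCA divff ?pnatr_eq0 // mulr1.
case: n => [|n]; first by rewrite mul0r addr0.
by rewrite mulrCA divff ?pnatr_eq0 // mulr1 [in RHS]factS natrM lnM ?posrE ?ltr0n ?fact_gt0.
Qed.

(** The cardinality is the permanent of the 0-1 matrix whose row [i] is the indicator of [A i]. *)
Definition perms_in (I : finType) (A : I -> {set I}) : {set {perm I}} :=
  [set s : {perm I} | [forall i, s i \in A i]].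

(** The minor without row [i] and column [k], padded to keep the index type. *)
Definition force (I : finType) (A : I -> {set I}) (i k : I) : I -> {set I} :=
  fun j => if j == i then [set k] else A j :\ k.

Lemma perms_in_force (I : finType) (A : I -> {set I}) (i k : I) :
  k \in A i -> perms_in (force A i k) = [set s in perms_in A | s i == k].
Proof.
move=> kA; apply/setP => s; rewrite !inE; apply/forallP/andP => [H|[/forallP H /eqP sik] j].
  have sik : s i = k by have := H i; rewrite /force eqxx inE => /eqP.
  split; last by rewrite sik.
  apply/forallP => j; have := H j; rewrite /force.
  by case: eqP => [->|_]; rewrite ?sik // inE => /andP[].
rewrite /force; case: eqP => [->|/eqP ji]; first by rewrite inE sik.
by rewrite !inE H -sik (inj_eq perm_inj) ji.
Qed.

(* The rows outside [D] are already decided, and their values are removed from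
   all other rows; this replaces the minors of the matrix in an induction on
   its size. *)
Lemma ln_card_perms_in_decided (R : realType) (I : finType) (A : I -> {set I})
    (D : {set I}) :
  (forall i, i \notin D -> exists2 k, A i = [set k]
      & forall j, j != i -> k \notin A j) ->
  ln (#|perms_in A|%:R : R) <= \sum_(i in D) lnfact_mean R #|A i|.
Proof.
elim: {D}#|D| {-2}D A (erefl #|D|) => [|m IH] D A cardD decided.
  have D0 : D = set0 by apply: cards0_eq.
  rewrite D0 big_set0; apply: ln_le0; rewrite lern1.
  apply/card_le1P => s sA t; rewrite [RHS]inE; apply/idP/eqP => [tA|->]; last by [].
  apply/permP => i; have [|k Ak _] := decided i; first by rewrite D0 inE.
  by move: sA tA; rewrite !inE => /forallP/(_ i) + /forallP/(_ i); rewrite Ak !inE => /eqP-> /eqP->.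
(* Here [ln 0 = 0] by convention, and the bound is nonnegative. *)
have [P0|P0] := posnP #|perms_in A|.
  by rewrite P0 ln0 //; apply: sumr_ge0 => i _; apply: lnfact_mean_ge0.
pose P := perms_in A.
have sA s i : s \in P -> s i \in A i by rewrite inE => /forallP.
(* The fiber over [s i] is the family forced at [i], to which the induction hypothesis applies with
   [i] moved out of [D]. *)
have decide s i : s \in P -> i \in D ->
    ln (#|[set t in P | t i == s i]|%:R : R)
    <= \sum_(j in D | j != i) lnfact_mean R (#|A j| - (s i \in A j)).
  move=> sP iD; rewrite -perms_in_force ?sA //.
  apply: le_trans (IH (D :\ i) _ _ _) _.
  - by have := cardsD1 i D; rewrite iD cardD => -[].
  - move=> j; rewrite !inE negb_and negbK => /orP[/eqP->|jD].
      exists (s i); first by rewrite /force eqxx.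
      by move=> l li; rewrite /force (negPf li) !inE eqxx.
    have [k Ak kA] := decided j jD.
    have ji : j != i by apply: contraNneq jD => ->.
    have ks : k != s i by apply: contraNneq (kA i _) => [->|]; rewrite ?sA // eq_sym.
    exists k.
      rewrite /force (negPf ji) Ak; apply/setP => x; rewrite !inE.
      by case: (x =P k) => [->|]; rewrite ?ks ?andbF.
    move=> l lj; rewrite /force; case: eqP => _; first by rewrite inE.
    by rewrite inE negb_and kA // orbT.
  - rewrite le_eqVlt; apply/orP; left; apply/eqP.
    apply: eq_big => [j|j]; first by rewrite !inE andbC.
    rewrite !inE => /andP[ji jD]; rewrite /force (negPf ji).
    by rewrite (cardsD1 (s i) (A j)) addKn.
(* Double count: fix [j] and let [i] range over [D]. The term [i = j] gives [ln #|A j|]; as [s] is a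
   bijection, [#|A j| - 1] of the other [i] shorten [A j] and [m.+1 - #|A j|] leave it intact.
   [lnfact_meanS] merges the first two groups. *)
have rows s : s \in P ->
    \sum_(i in D) (ln (#|A i|%:R : R) +
       \sum_(j in D | j != i) lnfact_mean R (#|A j| - (s i \in A j)))
    = m.+1%:R * \sum_(j in D) lnfact_mean R #|A j|.
  move=> sP; rewrite big_split /= (exchange_big_dep (mem D)) /=; last first.
    by move=> i j _ /andP[].
  rewrite -big_split mulr_sumr; apply: eq_bigr => j jD /=.
  pose C := [set i in D | j != i & s i \in A j].
  (* No row outside [D] takes a value in [A j], since decided values are removed from all other
     rows. *)
  have sAj : s @^-1: A j = j |: C.
    apply/setP => i; rewrite !inE (eq_sym i); case: eqP => [<-|/eqP ji] /=; first exact: sA.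
    case: (boolP (i \in D)) => //= iD; have [k Ak kA] := decided i iD.
    by move: (sA _ i sP); rewrite Ak inE => /eqP->; rewrite (negPf (kA j ji)).
  have cardAj : #|A j| = #|C|.+1.
    rewrite -(card_preimset (A j) (@perm_inj _ s)) sAj cardsU1 !inE eqxx /= andbF //.
  have CD : (#|C| <= m)%N.
    rewrite -ltnS -cardD -cardAj -(card_preimset (A j) (@perm_inj _ s)) sAj.
    by apply: subset_leq_card; apply/subsetP => i; rewrite !inE => /orP[/eqP->//|/andP[]].
  rewrite (bigID (fun i => s i \in A j)) /=.
  rewrite (eq_bigr (fun=> lnfact_mean R #|C|)); last first.
    by move=> i /andP[_ ->]; rewrite cardAj subn1.
  rewrite (eq_bigl [in C]); last first.
    by move=> i; rewrite !inE jD /= -andbA.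
  rewrite sumr_const.
  rewrite (eq_bigr (fun=> lnfact_mean R #|A j|)); last first.
    by move=> i /andP[_ /negPf->]; rewrite subn0.
  rewrite (eq_bigl [in D :\: (j |: C)]); last first.
    move=> i; rewrite !inE jD /= (eq_sym i).
    by case: (j == i); case: (i \in D); case: (s i \in A j).
  rewrite sumr_const cardsD (setIidPr _); last first.
    by apply/subsetP => i; rewrite !inE => /orP[/eqP->//|/andP[]].
  rewrite cardsU1 !inE eqxx /= andbF /= add1n cardD subSS addrA.
  rewrite -[lnfact_mean R #|C| *+ _]mulr_natl cardAj lnfact_meanS -[X in _ + X]mulr_natl -mulrDl -natrD.
  by congr (_%:R * _); lia.
(* Sum the Jensen bound for the map [s |-> s i] over all [i] in [D]; afterwards [m.+1 * #|P|]
   cancels. *)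
have key : \sum_(i in D) \sum_(s in P) ln (#|P|%:R : R) <=
    \sum_(s in P) m.+1%:R * \sum_(j in D) lnfact_mean R #|A j|.
  rewrite -(eq_bigr _ rows) [leRHS]exchange_big; apply: ler_sum => i iD /=.
  apply: le_trans (sum_ln_fiber_le R (sA ^~ i)) _.
  by apply: ler_sum => s sP; rewrite lerD2l decide.
move: key; rewrite !sumr_const cardD -!mulrnA mulnC mulr_natl -mulrnA.
by rewrite mulnC lerMn2r muln_eq0 -/P (gtn_eqF P0).
Qed.

Lemma ln_card_perms_in (R : realType) (I : finType) (A : I -> {set I}) :
  ln (#|perms_in A|%:R : R) <= \sum_i lnfact_mean R #|A i|.
Proof.
apply: le_trans (ln_card_perms_in_decided R (D := setT) _) _.
  by move=> i; rewrite inE.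
by rewrite (eq_bigl xpredT) // => i; rewrite inE.
Qed.

Definition root_fact (R : realType) (n : nat) : R := ((n`!)%:R : R) `^ (1 / n%:R).

Lemma bregman (R : realType) (I : finType) (A : I -> {set I}) :
  #|perms_in A|%:R <= \prod_i root_fact R #|A i|.
Proof.
have root_gt0 n : 0 < root_fact R n by rewrite powR_gt0 // ltr0n fact_gt0.
have prod_gt0 : 0 < \prod_i root_fact R #|A i| by apply: prodr_gt0.
have [->|P0] := posnP #|perms_in A|; first exact: ltW.
rewrite -ler_ln ?posrE ?ltr0n //; apply: le_trans (ln_card_perms_in R A) _.
suff -> : ln (\prod_i root_fact R #|A i|) = \sum_i lnfact_mean R #|A i| by [].
(* Positivity of the product is carried through the induction because [lnM] needs it. *)
apply: (@proj2 (0 < \prod_i root_fact R #|A i|)).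
elim/big_ind2: _ => [|x u y v [x0 <-] [y0 <-]|i _]; first by rewrite ltr01 ln1.
  by rewrite mulr_gt0 // lnM.
by rewrite root_gt0 ln_powR mul1r mulrC.
Qed.

(** * Extending partial injections to permutations *)

Definition partial_inj (I J : eqType) (f : I -> option J) : Prop :=
  forall j j' k, f j = Some k -> f j' = Some k -> j = j'.

(** Positions are treated one at a time: the transposition of [s j] and [k] corrects the value at
    [j] and, by injectivity, moves no value prescribed at an earlier position. *)
Lemma partial_inj_perm (I : finType) (f : I -> option I) :
  partial_inj f -> exists s : {perm I}, forall j k, f j = Some k -> s j = k.
Proof.
move=> injf.
suff [s sP] : exists s : {perm I},
    forall j, j \in enum I -> forall k, f j = Some k -> s j = k.
  by exists s => j; apply: sP; rewrite mem_enum.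
elim: (enum I) => [|j l [s sP]]; first by exists 1%g.
have [jl|jl] := boolP (j \in l).
  by exists s => j'; rewrite inE => /orP[/eqP->|]; apply: sP.
case fj: (f j) => [k|]; last first.
  by exists s => j'; rewrite inE => /orP[/eqP-> ?|/sP//]; rewrite fj.
exists (s * tperm (s j) k)%g => j'; rewrite inE permM.
have [-> _ k'|j'j /= j'l k' fj'] := eqVneq j' j; first by rewrite fj tpermL => -[].
rewrite (sP _ j'l _ fj') tpermD // -?(sP _ j'l _ fj') ?(inj_eq perm_inj) 1?eq_sym //.
apply: contraNneq j'j => sk; apply/eqP/(injf _ _ k) => //.
by rewrite fj' -sk (sP _ j'l _ fj').
Qed.

(** Choose one extension [e f] of each [f] and precompose it with the permutations [t] fixing [C]
    pointwise. The results are distinct: their values on [C] determine [f], and cancelling [e f]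
    then determines [t]. *)
Lemma card_partial_inj_le (I : finType) (A : I -> {set I}) (C : {set I})
    (F : {set {ffun I -> option I}}) :
  (forall f, f \in F -> [/\ partial_inj f, forall j, (f j != None) = (j \in C)
     & forall j k, f j = Some k -> k \in A j]) ->
  (#|F| * #|~: C|`! <= #|perms_in (fun j => if j \in C then A j else setT)|)%N.
Proof.
move=> FP; have ext f : exists s : {perm I},
    (f \in F) ==> [forall j, forall k, (f j == Some k) ==> (s j == k)].
  have [/FP[/partial_inj_perm[s sP] _ _]|_] := boolP (f \in F); last by exists 1%g.
  by exists s; do 2![apply/forallP => ?]; apply/implyP => /eqP/sP->.
pose e f := xchoose (ext f).
have eP f : f \in F -> forall j k, f j = Some k -> e f j = k.
  move=> fF j k fjk; have /implyP/(_ fF) := xchooseP (ext f).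
  by move=> /forallP/(_ j)/forallP/(_ k); rewrite fjk eqxx => /eqP.
pose T := [set t | perm_on (~: C) t].
have cardT : #|T| = #|~: C|`!.
  by rewrite -card_perm; apply: eq_card => t; rewrite inE.
have fixC (t : {perm I}) j : t \in T -> j \in C -> t j = j.
  by rewrite inE => tT jC; apply: out_perm tT _; rewrite inE negbK.
rewrite -cardT -cardsX -(@card_in_imset _ _ (fun p => (p.2 * e p.1)%g)); last first.
  move=> [f t] [f' t'] /=; rewrite !in_setX /= => /andP[fF tT] /andP[f'F t'T] eqE.
  have ff' : f = f'.
    apply/ffunP => j; have [jC|jC] := boolP (j \in C).
      have [_ + _] := FP f fF; have [_ + _] := FP f' f'F.
      move=> /(_ j) + /(_ j); rewrite jC.
      case f'j: (f' j) => [k'|] // _; case fj: (f j) => [k|] // _.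
      rewrite -(eP f fF j k fj) -(eP f' f'F j k' f'j).
      by move/permP/(_ j): eqE; rewrite !permM (fixC t) ?(fixC t') // => ->.
    have [_ + _] := FP f fF; have [_ + _] := FP f' f'F.
    by move=> /(_ j) + /(_ j); rewrite (negPf jC) => /negbFE/eqP-> /negbFE/eqP->.
  by move: eqE; rewrite ff' => /mulIg->.
apply: subset_leq_card; apply/subsetP => _ /imsetP[[f t] /= + ->].
rewrite in_setX /= => /andP[fF tT]; rewrite inE; apply/forallP => j.
have [jC|_] := ifP; last by rewrite inE.
rewrite permM (fixC t) //; have [_ /(_ j) + fA] := FP f fF; rewrite jC.
by case fj: (f j) => [k|] // _; rewrite (eP f fF j k fj) fA.
Qed.

(** * Filling the array row by row *)

Lemma partial_latin_squareP (n : nat) (L : partial_array n) :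
  reflect ((forall i, partial_inj (fun j => L (i, j))) /\
           (forall j, partial_inj (fun i => L (i, j))))
    (partial_latin_square L).
Proof.
apply: (iffP andP) => -[rowL colL]; split.
- move=> i j j' k Lj Lj'; have /forallP/(_ i)/forallP/(_ k)/card_le1_eqP := rowL.
  by apply; rewrite inE; apply/eqP.
- move=> j i i' k Lj Lj'; have /forallP/(_ j)/forallP/(_ k)/card_le1_eqP := colL.
  by apply; rewrite inE; apply/eqP.
- apply/forallP => i; apply/forallP => k; apply/card_le1_eqP => j j'.
  by rewrite !inE => /eqP Lj /eqP Lj'; apply: (rowL i _ _ k).
- apply/forallP => j; apply/forallP => k; apply/card_le1_eqP => i i'.
  by rewrite !inE => /eqP Lj /eqP Lj'; apply: (colL j _ _ k).
Qed.

Definition pls_of_shape (n : nat) (S : {set 'I_n * 'I_n}) :=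
  [set L : partial_array n | partial_latin_square L & pls_shape L == S].

Definition rows_below (n : nat) (S : {set 'I_n * 'I_n}) (t : nat) :=
  [set x in S | (x.1 < t)%N].

Definition col_card_below (n : nat) (S : {set 'I_n * 'I_n}) (t : nat) (j : 'I_n) :=
  #|[set i | (i, j) \in rows_below S t]|.

Definition truncate_rows (n : nat) (t : nat) (L : partial_array n) : partial_array n :=
  [ffun x : 'I_n * 'I_n => if (x.1 < t)%N then L x else None].

Lemma truncate_rows_pls (n : nat) (S : {set 'I_n * 'I_n}) t (L : partial_array n) :
  L \in pls_of_shape (rows_below S t.+1) ->
  truncate_rows t L \in pls_of_shape (rows_below S t).
Proof.
rewrite !inE => /andP[/partial_latin_squareP[rowL colL] /eqP shL].
apply/andP; split.
  apply/partial_latin_squareP; split.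
    by move=> i j j' k; rewrite !ffunE /=; case: ifP => // _; apply: rowL.
  move=> j i i' k; rewrite !ffunE /=; case: ifP => // _ Li; case: ifP => // _.
  exact: colL.
apply/eqP/setP => x; rewrite !inE ffunE.
case: ifP => [xt|_]; last by rewrite andbF.
have := congr1 (fun Z : {set _} => x \in Z) shL; rewrite /pls_shape !inE => ->.
by rewrite ltnS ltnW.
Qed.

(* Bregman's bound on the matrix with columns of the array as rows: an empty
   cell of row [i] becomes an all-ones row, and every filling of row [i]
   extends to a permutation in [#|~: C|`!] ways. *)
Lemma card_pls_fiber_le (R : realType) (n : nat) (S : {set 'I_n * 'I_n}) (i : 'I_n)
    (M : partial_array n) (C := [set j | (i, j) \in S]) :
  M \in pls_of_shape (rows_below S i) ->
  #|[set L in pls_of_shape (rows_below S i.+1) | truncate_rows i L == M]|%:R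
    <= (\prod_(j in C) root_fact R (n - col_card_below S i j))
       * root_fact R n ^+ #|~: C| / (#|~: C|`!)%:R.
Proof.
move=> MP; set X := [set L in _ | _].
pose used j := [set k | [exists i' : 'I_n, M (i', j) == Some k]].
have card_used j : #|used j| = col_card_below S i j.
  move: MP; rewrite inE => /andP[/partial_latin_squareP[_ colM] /eqP shM].
  (* The symbol in row [i'] of column [j], with a default making [h] total; the Latin property makes
     it injective on the filled cells. *)
  pose h (i' : 'I_n) := odflt i' (M (i', j)).
  have MS i' : (i' \in [set i0 | (i0, j) \in rows_below S i]) = (M (i', j) != None).
    by rewrite inE -shM inE.
  rewrite /col_card_below -[RHS](@card_in_imset _ _ h); last first.
    move=> i1 i2; rewrite !MS /h.
    case M1: (M (i1, j)) => [k1|] // _; case M2: (M (i2, j)) => [k2|] // _ /= k12.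
    by apply: (colM j _ _ k1); rewrite // M2 k12.
  apply: eq_card => k; rewrite inE; apply/existsP/imsetP.
    by move=> [i' /eqP Mk]; exists i'; rewrite ?MS /h Mk.
  move=> [i']; rewrite MS /h; case Mk: (M (i', j)) => [k'|] // _ /= ->.
  by exists i'; rewrite Mk.
pose row L : {ffun 'I_n -> option 'I_n} := [ffun j => (L : partial_array n) (i, j)].
have XP L : L \in X -> [/\ partial_latin_square L,
    forall x : 'I_n * 'I_n, (L x != None) = (x \in S) && (x.1 <= i)%N
    & forall x : 'I_n * 'I_n, (x.1 < i)%N -> L x = M x].
  rewrite !inE => /andP[/andP[Lpls /eqP shL] /eqP LM]; split=> // x.
    have := congr1 (fun Z : {set _} => x \in Z) shL.
    by rewrite /pls_shape !inE ltnS.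
  by move=> xi; rewrite -LM ffunE xi.
(* A member of [X] agrees with [M] above row [i] and is empty below it. *)
have row_inj : {in X &, injective row}.
  move=> L L' /XP[_ sh eqM] /XP[_ sh' eqM'] /ffunP rowE; apply/ffunP => x.
  have [xi|ix|xi] := ltngtP x.1 i; first by rewrite eqM // eqM'.
    have := sh x; have := sh' x; rewrite leqNgt ix andbF.
    by move=> /negbFE/eqP-> /negbFE/eqP->.
  have := rowE x.2; rewrite !ffunE.
  by rewrite (_ : (i, x.2) = x) //; case: x xi {rowE} => a b /= /val_inj->.
have : (#|X| * #|~: C|`! <= #|perms_in (fun j => if j \in C then ~: used j else setT)|)%N.
  rewrite -(card_in_imset row_inj); apply: card_partial_inj_le.
  move=> _ /imsetP[L /XP[/partial_latin_squareP[rowL colL] sh eqM] ->]; split.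
  - by move=> j j' k; rewrite !ffunE; apply: rowL.
  - by move=> j; rewrite ffunE sh leqnn andbT inE.
  - move=> j k; rewrite ffunE => Lk; rewrite !inE; apply/existsP => -[i' /eqP Mk].
    have i'i : (i' < i)%N.
      move: MP; rewrite inE => /andP[_ /eqP shM].
      have := congr1 (fun Z : {set _} => (i', j) \in Z) shM.
      by rewrite /pls_shape !inE Mk /= => /esym/andP[].
    have := eqM (i', j) i'i; rewrite Mk => Lk'.
    by have ii' := colL j _ _ k Lk Lk'; rewrite ii' ltnn in i'i.
rewrite -(ler_nat R) natrM => le_perms.
rewrite ler_pdivlMr ?ltr0n ?fact_gt0 //; apply: le_trans le_perms _.
apply: le_trans (bregman R _) _.
rewrite (bigID (mem C)) /= -prodr_const.
rewrite le_eqVlt; apply/orP; left; apply/eqP; congr (_ * _).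
  apply: eq_bigr => j /= jC; rewrite jC; congr root_fact.
  by rewrite -card_used [LHS]cardsCs setCK card_ord.
rewrite [RHS](eq_bigl (fun j => j \notin C)); last by move=> j; rewrite inE.
by apply: eq_bigr => j /negPf->; rewrite cardsT card_ord.
Qed.

Lemma card_pls_row_le (R : realType) (n : nat) (S : {set 'I_n * 'I_n}) (i : 'I_n)
    (C := [set j | (i, j) \in S]) :
  #|pls_of_shape (rows_below S i.+1)|%:R
    <= #|pls_of_shape (rows_below S i)|%:R *
       ((\prod_(j in C) root_fact R (n - col_card_below S i j))
       * root_fact R n ^+ #|~: C| / (#|~: C|`!)%:R).
Proof.
rewrite -sum1_card natr_sum.
(* The bound on a fiber is the same for every [M], so summing over [M] multiplies it by the number
   of fillings of the rows above [i]. *)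
rewrite (partition_big (@truncate_rows n i) [in pls_of_shape (rows_below S i)]) /=; last first.
  by move=> L; apply: truncate_rows_pls.
rewrite mulr_natl -sumr_const; apply: ler_sum => M MP.
apply: le_trans (card_pls_fiber_le R MP).
rewrite le_eqVlt -[in X in _ == X]sum1_card natr_sum; apply/orP; left; apply/eqP.
by apply: eq_bigl => L; rewrite [RHS]inE.
Qed.

Lemma card_pls_rows_below_le (R : realType) (n : nat) (S : {set 'I_n * 'I_n}) t :
  (t <= n)%N ->
  #|pls_of_shape (rows_below S t)|%:R
    <= (\prod_(i < n | (i < t)%N)
          (root_fact R n ^+ #|~: [set j | (i, j) \in S]|
           / (#|~: [set j | (i, j) \in S]|`!)%:R))
       * \prod_(j < n) \prod_(0 <= k < col_card_below S t j) root_fact R (n - k).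
Proof.
elim: t => [_|t IH tn].
  (* At [t = 0] the only array is the empty one, and both products equal 1. *)
  rewrite big_pred0 // mul1r big1 ?lern1 => [|j _].
    apply/card_le1_eqP => L L'; rewrite !inE.
    suff none (L0 : partial_array n) : pls_shape L0 == rows_below S 0 -> L0 = [ffun=> None].
      by move=> /andP[_ /none->] /andP[_ /none->].
    move=> /eqP sh; apply/ffunP => x; rewrite ffunE.
    have := congr1 (fun Z : {set _} => x \in Z) sh.
    by rewrite /pls_shape !inE ltn0 andbF => /negbFE/eqP.
  rewrite big_geq // /col_card_below leqn0 cards_eq0; apply/eqP/setP => i.
  by rewrite !inE ltn0 andbF.
pose i := Ordinal tn; apply: le_trans (card_pls_row_le R S i) _.
apply: le_trans (ler_wpM2r _ (IH (ltnW tn))) _.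
  rewrite !mulr_ge0 ?invr_ge0 ?ler0n ?exprn_ge0 ?powR_ge0 ?prodr_ge0 // => j _.
  exact: powR_ge0.
rewrite [X in _ <= X * _](bigD1 i) //= [X in _ <= _ * X * _](eq_bigl (fun i' : 'I_n => (i' < t)%N)); last first.
  move=> i'; rewrite ltnS -val_eqE /= andbC; case: ltngtP => //.
(* Column [j] gains a factor only if [(i, j)] is in the shape, and it is the next one, so the
   indices descend consecutively from [n]. *)
have colS j : \prod_(0 <= k < col_card_below S t.+1 j) root_fact R (n - k)
   = \prod_(0 <= k < col_card_below S t j) root_fact R (n - k)
     * (if (i, j) \in S then root_fact R (n - col_card_below S t j) else 1).
  have -> : col_card_below S t.+1 j = (col_card_below S t j + ((i, j) \in S))%N.
    rewrite /col_card_below (cardsD1 i [set i0 | (i0, j) \in rows_below S t.+1]) addnC.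
    congr (_ + _)%N; last by rewrite !inE /= ltnSn andbT.
    apply: eq_card => i'; rewrite !inE /= ltnS -val_eqE /= andbCA.
    by congr (_ && _); case: ltngtP.
  by case: ifP; rewrite ?addn1 ?addn0 ?mulr1 // big_nat_recr.
have -> : \prod_(j < n) \prod_(0 <= k < col_card_below S t.+1 j) root_fact R (n - k)
   = (\prod_(j < n) \prod_(0 <= k < col_card_below S t j) root_fact R (n - k))
     * \prod_(j in [set j | (i, j) \in S]) root_fact R (n - col_card_below S t j).
  rewrite (eq_bigr _ (fun j _ => colS j)) big_split /= -big_mkcond; congr (_ * _).
  by apply: eq_bigl => j; rewrite inE.
by rewrite le_eqVlt; apply/orP; left; apply/eqP; ring.
Qed.

Theorem theorem2 (R : realType) (n : nat) (n_gt0 : (0 < n)%N)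
    (S : {set 'I_n * 'I_n}) (r c : 'I_n -> nat)
    (row_count : forall i : 'I_n, #|[set j : 'I_n | (i, j) \in S]| = r i)
    (col_count : forall j : 'I_n, #|[set i : 'I_n | (i, j) \in S]| = c j) :
  (#|[set L : partial_array n | partial_latin_square L & pls_shape L == S]|%:R : R)
  <= (\prod_(i < n)
        (((n `!)%:R : R) `^ ((n%:R - (r i)%:R) / n%:R)
         * (1 / ((n - r i) `!)%:R)))
     * (\prod_(i < n) \prod_(0 <= j < c i)
          (((n - j) `!)%:R : R) `^ (1 / (n - j)%:R)).
Proof.
have Sn : rows_below S n = S by apply/setP => x; rewrite inE ltn_ord andbT.
have := card_pls_rows_below_le R S (leqnn n); rewrite Sn => /le_trans; apply.
rewrite le_eqVlt; apply/orP; left; apply/eqP; congr (_ * _).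
  apply: eq_big => [i|i _]; first exact: ltn_ord.
  have -> : #|~: [set j | (i, j) \in S]| = (n - r i)%N.
    by rewrite cardsCs setCK card_ord row_count.
  have rn : (r i <= n)%N by rewrite -row_count -[n in (_ <= n)%N]card_ord max_card.
  (* The [n - r i] factors [root_fact R n] multiply their exponents to [(n - r i) / n]; [r i <= n]
     makes the truncated subtraction agree with the real one. *)
  rewrite /root_fact -powR_mulrn ?powR_ge0 // -powRrM natrB //.
  by rewrite !mul1r [_^-1 * _]mulrC.
by apply: eq_bigr => j _; rewrite /col_card_below Sn col_count.
Qed.
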